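(* Let $a,b,c\in\mathbb C$ and $d\in\mathbb N$ be such that the $\Re$-module $R_d(a,b,c)$ is irreducible. Then the following are equivalent: (i) $A,B,C$ act on $R_d(a,b,c)$ as a Leonard triple; (ii) $A,B,C$ are each diagonalizable on $R_d(a,b,c)$; (iii) none of $a,b,c$ belongs to $\{\frac{i-d-1}{2}\mid i=1,2,\dots,2d-1\}$.
   Context: $\Re$ is the unital associative $\mathbb C$-algebra generated by $A,B,C,\Delta$ with $[A,B]=[B,C]=[C,A]=2\Delta$ and such that $\alpha=[A,\Delta]+AC-BA$, $\beta=[B,\Delta]+BA-CB$, $\gamma=[C,\Delta]+CB-AC$ are central; $\delta=A+B+C$. For $a,b,c\in\mathbb C$, $d\in\mathbb N$, $R_d(a,b,c)$ denotes the $(d+1)$-dimensional $\Re$-module (known to exist, determined up to isomorphism by these data) having a basis with respect to which $A$ is the lower bidiagonal matrix with diagonal $\theta_i=(a+\frac d2-i)(a+\frac d2-i+1)$ ($0\le i\le d$) and subdiagonal entries $1$; $B$ is the upper bidiagonal matrix with diagonal $\theta^*_i=(b+\frac d2-i)(b+\frac d2-i+1)$ and superdiagonal $\varphi_i=i(i-d-1)(a+b+c+\frac d2-i+2)(a+b-c+\frac d2-i+1)$ ($1\le i\le d$); and $\alpha,\beta,\gamma,\delta$ act as the scalars $(c-b)(c+b+1)(a-\frac d2)(a+\frac d2+1)$, $(a-c)(a+c+1)(b-\frac d2)(b+\frac d2+1)$, $(b-a)(b+a+1)(c-\frac d2)(c+\frac d2+1)$, $\frac d2(\frac d2+1)+a(a+1)+b(b+1)+c(c+1)$.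 A square matrix is tridiagonal if every nonzero entry lies on the diagonal, subdiagonal or superdiagonal, and irreducible tridiagonal if moreover all sub- and superdiagonal entries are nonzero. An ordered triple $L,L^*,L^\varepsilon$ of linear operators on a finite-dimensional nonzero space $V$ is a Leonard triple if for each of the three operators there is a basis of $V$ in which that operator is diagonal and the other two are irreducible tridiagonal. *)

(* Defs.v *)
(* The complex field C is rendered as R[i] (mathcomp-real-closed
   complex numbers) over an arbitrary R : realType (i.e. the reals). *)
From HB Require Import structures.
From mathcomp Require Import all_boot all_order all_algebra.
From mathcomp Require Import reals.
From mathcomp Require Import complex.

Set Implicit Arguments.
Unset Strict Implicit.
Unset Printing Implicit Defensive.

Import Order.TTheory GRing.Theory Num.Theory.
Local Open Scope ring_scope.

Section RdModule.
Variable F : fieldType.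

(* Matrices act on column vectors: the matrix of an operator M in the basis
   given by the columns of an invertible P is  invmx P *m M *m P. *)

Definition tridiagonal n (M : 'M[F]_n) : Prop :=
  forall i j : 'I_n, (i.+1 < j)%N \/ (j.+1 < i)%N -> M i j = 0.

Definition irred_tridiagonal n (M : 'M[F]_n) : Prop :=
  tridiagonal M /\
  forall i j : 'I_n, (j = i.+1 :> nat) \/ (i = j.+1 :> nat) -> M i j != 0.

Definition diagonal n (M : 'M[F]_n) : Prop := forall i j : 'I_n, i != j -> M i j = 0.

Definition leonard_triple n (L L' L'' : 'M[F]_n) : Prop :=
  [/\ (0 < n)%N,
   (exists2 P : 'M[F]_n, P \in unitmx &
      [/\ diagonal (invmx P *m L *m P),
          irred_tridiagonal (invmx P *m L' *m P) &
          irred_tridiagonal (invmx P *m L'' *m P)]),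
   (exists2 P : 'M[F]_n, P \in unitmx &
      [/\ diagonal (invmx P *m L' *m P),
          irred_tridiagonal (invmx P *m L *m P) &
          irred_tridiagonal (invmx P *m L'' *m P)]) &
   (exists2 P : 'M[F]_n, P \in unitmx &
      [/\ diagonal (invmx P *m L'' *m P),
          irred_tridiagonal (invmx P *m L *m P) &
          irred_tridiagonal (invmx P *m L' *m P)])].

(** operator M (acting on column vectors) leaves the subspace spanned by the
    rows of U (viewed as column vectors) invariant *)
Definition mx_invariant n (U M : 'M[F]_n) : bool := (U *m M^T <= U)%MS.

Definition half_d (d : nat) : F := d%:R / 2.

Definition thetaR (x : F) (d i : nat) : F :=
  (x + half_d d - i%:R) * (x + half_d d - i%:R + 1).

Definition phiR (a b c : F) (d i : nat) : F :=
  i%:R * (i%:R - d%:R - 1) * (a + b + c + half_d d - i%:R + 2)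
       * (a + b - c + half_d d - i%:R + 1).

Definition RA (a : F) (d : nat) : 'M[F]_d.+1 :=
  \matrix_(i, j) (if i == j :> nat then thetaR a d i
                  else if i == j.+1 :> nat then 1 else 0).

Definition RB (a b c : F) (d : nat) : 'M[F]_d.+1 :=
  \matrix_(i, j) (if i == j :> nat then thetaR b d i
                  else if j == i.+1 :> nat then phiR a b c d j else 0).

(** scalar by which delta = A + B + C acts *)
Definition delta_R (a b c : F) (d : nat) : F :=
  half_d d * (half_d d + 1) + a * (a + 1) + b * (b + 1) + c * (c + 1).

Definition RC (a b c : F) (d : nat) : 'M[F]_d.+1 :=
  (delta_R a b c d)%:M - RA a d - RB a b c d.

Definition RDelta (a b c : F) (d : nat) : 'M[F]_d.+1 :=
  2^-1 *: (RA a d *m RB a b c d - RB a b c d *m RA a d).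

(** R_d(a,b,c) is irreducible: no subspace other than 0 and the whole space
    is invariant under the generators A, B, C, Delta (alpha, beta, gamma, delta
    act as scalars, so they leave every subspace invariant). *)
Definition Rd_irreducible (a b c : F) (d : nat) : Prop :=
  forall U : 'M[F]_d.+1,
    mx_invariant U (RA a d) -> mx_invariant U (RB a b c d) ->
    mx_invariant U (RC a b c d) -> mx_invariant U (RDelta a b c d) ->
    U == 0 \/ \rank U = d.+1.

Definition avoids_bad_set (d : nat) (x : F) : Prop :=
  forall i : nat, (1 <= i <= (2 * d).-1)%N -> x != (i%:R - d%:R - 1) / 2.

End RdModule.

(* Main.v *)
(** The subdiagonal ones make [RA x d] nonderogatory, so it is diagonalizable iff
    the [thetaR x d i] are distinct, i.e. iff [x] avoids the bad set. The same
    criterion applies to [B] and [C]: irreducibility forces every [phiR] to be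
    nonzero, so a diagonal rescaling turns the transpose of [B] into [RA b d],
    and an explicit unitriangular-up-to-sign matrix conjugates [C] to [RA c d].
    Hence each operator [L] of the triple has an eigenbasis whose eigenvalues are
    the [thetaR x d i] in their natural order. In that basis the Racah relation
    between [L] and another operator [M] of the triple reads, off the diagonal,
    [(u^2 - 1) (v^2 - 1) M_ij = 0] with [u = j - i] and [v = 2 x + d + 1 - i - j],
    which makes [M] tridiagonal; a zero next to the diagonal would produce an
    invariant subspace. *)
Require Import Defs.
From HB Require Import structures.
From mathcomp Require Import all_boot all_order all_algebra.
From mathcomp Require Import separable.
From mathcomp Require Import reals.
From mathcomp Require Import complex.
From mathcomp Require Import ring zify.

Set Implicit Arguments.
Unset Strict Implicit.
Unset Printing Implicit Defensive.

Import Order.TTheory GRing.Theory Num.Theory.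
Local Open Scope ring_scope.

(** * Diagonalizability, irreducible pairs of operators and the Racah relation, for arbitrary
    matrices *)

Section Matrices.
Variable F : fieldType.

Lemma sum_lower_bidiag d (f : nat -> F) (x y : F) (i : 'I_d.+1) :
  \sum_(k < d.+1) (if i == k :> nat then x else if i == k.+1 :> nat then y else 0)
    * f k = x * f i + (if i : nat is k.+1 then y * f k else 0).
Proof.
rewrite (bigD1 i) //= eqxx; congr (_ + _).
case: i => [[|k] ki] /=.
  rewrite big1 // => j; rewrite -val_eqE /= eq_sym => /negPf->.
  by rewrite mul0r.
pose j0 : 'I_d.+1 := Ordinal (ltnW ki).
rewrite (bigD1 j0) /=; last by rewrite -val_eqE /= neq_ltn ltnSn.
rewrite gtn_eqF // eqxx big1 ?addr0 // => j.
rewrite -!val_eqE /= => /andP[jk jk0]; rewrite eq_sym (negPf jk).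
by rewrite eqSS eq_sym (negPf jk0) mul0r.
Qed.

Lemma sum_upper_bidiag d (f y : nat -> F) (x : F) (i : 'I_d.+1) :
  \sum_(k < d.+1) (if i == k :> nat then x else if k == i.+1 :> nat then y k else 0)
    * f k = x * f i + (if (i < d)%N then y i.+1 * f i.+1 else 0).
Proof.
rewrite (bigD1 i) //= eqxx; congr (_ + _).
case: ifP => [ltid|/negbT]; last first.
  rewrite -leqNgt => ledi; rewrite big1 // => j.
  rewrite -val_eqE /= eq_sym => /negPf->; case: eqP => [ji|]; last by rewrite mul0r.
  by have := ltn_ord j; rewrite ji ltnS ltnNge ledi.
pose j0 : 'I_d.+1 := @Ordinal d.+1 i.+1 ltid.
rewrite (bigD1 j0) /=; last by rewrite -val_eqE /= gtn_eqF.
rewrite ltn_eqF // eqxx big1 ?addr0 // => j.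
rewrite -!val_eqE /= => /andP[ji ji0]; rewrite eq_sym (negPf ji).
by rewrite (negPf ji0) mul0r.
Qed.

Lemma diagonal_invmx n (L P : 'M[F]_n) (D : 'rV_n) :
  P \in unitmx -> L *m P = P *m diag_mx D -> invmx P *m L *m P = diag_mx D.
Proof. by move=> uP LP; rewrite -mulmxA LP mulKmx. Qed.

(** Passes from the row-vector convention of [diagonalizable] to eigenbases made of columns. *)
Lemma diagonalizable_col n (L : 'M[F]_n) :
  diagonalizable L <->
  exists2 P : 'M[F]_n, P \in unitmx & exists D : 'rV_n, L *m P = P *m diag_mx D.
Proof.
split=> [[P uP /diagonalizable_forPex[D /(simmxP uP) PL]]|[P uP [D LP]]].
  exists (invmx P); rewrite ?unitmx_inv //; exists D.
  by apply: (can_inj (mulKmx uP)); rewrite mulKVmx // mulmxA PL mulmxK.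
exists (invmx P); rewrite ?unitmx_inv //; apply/diagonalizable_forPex; exists D.
apply/simmxP; rewrite ?unitmx_inv //.
by apply: (can_inj (mulKmx uP)); rewrite mulKVmx // mulmxA -LP mulmxK.
Qed.

Lemma diagonal_diagonalizable n (L P : 'M[F]_n) :
  P \in unitmx -> diagonal (invmx P *m L *m P) -> diagonalizable L.
Proof.
move=> uP dL; apply/diagonalizable_col; exists P => //.
have [K KE] : exists K, K = invmx P *m L *m P by exists (invmx P *m L *m P).
rewrite -KE in dL; exists (\row_i K i i).
have -> : diag_mx (\row_i K i i) = K.
  apply/matrixP=> i j; rewrite !mxE.
  by have [->|ij] := eqVneq i j; rewrite ?mulr1n // (dL i j).
by rewrite KE !mulmxA mulmxV // mul1mx.
Qed.

Lemma diagonalizable_sim n (L M T : 'M[F]_n) :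
  T \in unitmx -> L *m T = T *m M -> diagonalizable L -> diagonalizable M.
Proof.
move=> uT LT /diagonalizable_col[P uP [D LP]]; apply/diagonalizable_col.
exists (invmx T *m P); first by rewrite unitmx_mul unitmx_inv uT.
exists D; apply: (can_inj (mulKmx uT)).
by rewrite 2!mulmxA -LT mulmxA mulmxK // LP !mulmxA mulmxV // mul1mx.
Qed.

Lemma diagonalizable_tr n (L : 'M[F]_n) : diagonalizable L -> diagonalizable L^T.
Proof.
move=> /diagonalizable_col[P uP [D LP]]; apply/diagonalizable_col.
exists (invmx P^T); rewrite ?unitmx_inv ?unitmx_tr //; exists D.
have uPT : P^T \in unitmx by rewrite unitmx_tr.
apply: (can_inj (mulKmx uPT)); rewrite mulKVmx // mulmxA -trmx_mul LP.
by rewrite trmx_mul tr_diag_mx mulmxK.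
Qed.

(** Two operators suffice: [C] and [Delta] are polynomials in [A] and [B], and [A] is recovered from
    [B], [C] through [delta]. *)
Definition irreducible_pair n (L M : 'M[F]_n) : Prop :=
  forall U : 'M[F]_n, mx_invariant U L -> mx_invariant U M ->
    U == 0 \/ \rank U = n.

(** The columns of [P] indexed by [S] would span an invariant subspace, nonzero because of [i0] and
    proper because of [j0]. *)
Lemma irreducible_pair_coord n (L M P : 'M[F]_n) (S : pred 'I_n) (i0 j0 : 'I_n) :
  irreducible_pair L M -> P \in unitmx -> S i0 -> ~~ S j0 ->
  (forall k l, S k -> ~~ S l -> (invmx P *m L *m P) l k = 0) ->
  (forall k l, S k -> ~~ S l -> (invmx P *m M *m P) l k = 0) -> False.
Proof.
move=> irr uP Si Sj hL hM.
(* Coordinate projection onto [S]: the nonzero rows of [E *m P^T] are the chosen columns of [P]. *)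
pose E : 'M[F]_n := diag_mx (\row_k (S k)%:R).
have inv N : (forall k l, S k -> ~~ S l -> (invmx P *m N *m P) l k = 0) ->
    mx_invariant (E *m P^T) N.
  have NP : N *m P = P *m (invmx P *m N *m P) by rewrite !mulmxA mulmxV // mul1mx.
  move: (invmx P *m N *m P) NP => K NP hN.
  have EK : E *m K^T = E *m K^T *m E.
    rewrite /E mul_diag_mx mul_mx_diag; apply/matrixP=> k l; rewrite !mxE.
    case Sl: (S l); first by rewrite mulr1.
    by case Sk: (S k); rewrite ?(mul0r,mul1r,mulr0) // hN // Sl.
  by rewrite /mx_invariant -mulmxA -trmx_mul NP trmx_mul mulmxA EK -mulmxA submxMl.
have := irr _ (inv _ hL) (inv _ hM); case=> [/eqP E0|rE].
  have /matrixP/(_ i0 i0) : E = 0.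
    have uPT : P^T \in unitmx by rewrite unitmx_tr.
    by rewrite -[E](mulmxK uPT) E0 mul0mx.
  by rewrite !mxE eqxx Si mulr1n => /eqP; rewrite oner_eq0.
have : E *m P^T \in unitmx by rewrite -row_free_unit /row_free rE.
rewrite unitmx_mul => /andP[uE _].
have : \det E = 0.
  by rewrite det_diag (bigD1 j0) //= !mxE (negPf Sj) mul0r.
by move=> dE; move: uE; rewrite unitmxE dE unitr0.
Qed.

(* A vanishing off-diagonal entry splits off an initial or final segment of
   the basis as an invariant subspace. *)
Lemma irreducible_pair_tridiag n (L M P : 'M[F]_n) :
  irreducible_pair L M -> P \in unitmx -> diagonal (invmx P *m L *m P) ->
  tridiagonal (invmx P *m M *m P) -> irred_tridiagonal (invmx P *m M *m P).
Proof.
move=> irr uP dL tM; split=> // i j [ji|ij]; apply/eqP => Mij0.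
  apply: (@irreducible_pair_coord _ L M P (fun k => i < k)%N j i irr uP).
  - by rewrite ji.
  - by rewrite ltnn.
  - move=> k l Sk Sl; apply: dL; apply: contraNneq Sl => ->; exact: Sk.
  move=> k l Sk; rewrite -leqNgt => li.
  have [kj|kj] := eqVneq (k : nat) j.
    have [eil|eil] := eqVneq (l : nat) i.
      by rewrite (val_inj kj) (val_inj eil).
    apply: tM; left; lia.
  apply: tM; left; lia.
apply: (@irreducible_pair_coord _ L M P (fun k => k <= j)%N j i irr uP).
- by rewrite leqnn.
- by rewrite ij ltnn.
- move=> k l Sk Sl; apply: dL; apply: contraNneq Sl => ->; exact: Sk.
move=> k l Sk; rewrite -ltnNge => li.
have [kj|kj] := eqVneq (k : nat) j.
  have [eil|eil] := eqVneq (l : nat) i.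
    by rewrite (val_inj kj) (val_inj eil).
  apply: tM; right; lia.
apply: tM; right; lia.
Qed.

Lemma mx_invariantD n (U M N : 'M[F]_n) :
  mx_invariant U M -> mx_invariant U N -> mx_invariant U (M + N).
Proof. by move=> hM hN; rewrite /mx_invariant linearD mulmxDr addmx_sub. Qed.

Lemma mx_invariantZ n (U M : 'M[F]_n) x :
  mx_invariant U M -> mx_invariant U (x *: M).
Proof. by move=> hM; rewrite /mx_invariant linearZ -scalemxAr scalemx_sub. Qed.

Lemma mx_invariantN n (U M : 'M[F]_n) : mx_invariant U M -> mx_invariant U (- M).
Proof. by rewrite -scaleN1r; apply: mx_invariantZ. Qed.

Lemma mx_invariantM n (U M N : 'M[F]_n) :
  mx_invariant U M -> mx_invariant U N -> mx_invariant U (M *m N).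
Proof.
move=> hM hN; rewrite /mx_invariant trmx_mul mulmxA.
exact: submx_trans (submxMr _ hN) hM.
Qed.

Lemma mx_invariant_scalar n (U : 'M[F]_n) x : mx_invariant U x%:M.
Proof. by rewrite /mx_invariant tr_scalar_mx mul_mx_scalar scalemx_sub. Qed.

(* For [(L, M) = (A, B)] this is twice the relation [[A, Delta] + A C - B A = alpha]
   with [C = del - A - B] and [Delta = [A, B] / 2] substituted. *)
Definition racah_rel n (del ka : F) (L M : 'M[F]_n) : Prop :=
  L *m L *m M - 2 *: (L *m M *m L) + M *m L *m L - 2 *: (L *m M)
    - 2 *: (M *m L) - 2 *: (L *m L) + (2 * del) *: L = ka%:M.

Lemma racah_rel_conj n del ka (L M P : 'M[F]_n) :
  P \in unitmx -> racah_rel del ka L M ->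
  racah_rel del ka (invmx P *m L *m P) (invmx P *m M *m P).
Proof.
move=> uP LM; rewrite /racah_rel !mulmxA.
rewrite !mulmxK //.
have -> : ka%:M = invmx P *m (ka%:M) *m P.
  by rewrite mul_mx_scalar -scalemxAl mulVmx // scalemx1.
rewrite -LM !(mulmxDr, mulmxDl, mulmxN, mulNmx) -?scalemxAr -?scalemxAl.
by rewrite !mulmxA.
Qed.

Lemma racah_rel_third n del ka kb (A B : 'M[F]_n) :
  racah_rel del ka A B -> racah_rel del kb B A ->
  racah_rel del (ka - kb) (del%:M - A - B) B.
Proof.
rewrite /racah_rel => rA rB.
have -> : (ka - kb)%:M = ka%:M - kb%:M :> 'M[F]_n by rewrite raddfB.
rewrite -rA -rB.
rewrite !(mulmxDr, mulmxDl, mulmxN, mulNmx, mul_mx_scalar, mul_scalar_mx,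
  =^~ scalemxAl, =^~ scalemxAr).
rewrite -scalemx1 ?mulmxA.
(* Once the noncommutative words are opaque matrices, the identity is linear in them and [ring] can
   check it entrywise. *)
move: (A *m A *m B) (A *m B *m A) (B *m A *m A) => AAB ABA BAA.
move: (B *m B *m A) (B *m A *m B) (A *m B *m B) (B *m B *m B) => BBA BAB ABB BBB.
move: (A *m A) (A *m B) (B *m A) (B *m B) => AA AB BA BB.
move: (1%:M : 'M[F]_n) => I1.
apply/matrixP=> i j; rewrite !mxE.
ring.
Qed.
End Matrices.

(** * The Racah relations for [A], [B] and [C] *)

Section Racah.
Variable F : numFieldType.
Implicit Types (a b c x : F) (d : nat).

Lemma natr_half d : d%:R = 2 * half_d F d.
Proof. by rewrite /half_d mulrCA mulfV ?mulr1 // pnatr_eq0. Qed.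

(* The actions of [RA] and [RB] on columns, extended to sequences indexed by
   all of nat; [RB] is not affected by the extension since [phiR] vanishes at
   [d.+1]. *)
Definition opA a d (f : nat -> nat -> F) (i j : nat) : F :=
  thetaR a d i * f i j + (if i is k.+1 then f k j else 0).

Definition opB a b c d (f : nat -> nat -> F) (i j : nat) : F :=
  thetaR b d i * f i j + phiR a b c d i.+1 * f i.+1 j.

Lemma phiR_last a b c d : phiR a b c d d.+1 = 0.
Proof. by rewrite /phiR -natr1 (_ : d%:R + 1 - d%:R - 1 = 0) ?mulr0 ?mul0r //; ring. Qed.

Lemma RA_mul a d m (f : nat -> nat -> F) :
  RA a d *m (\matrix_(i < d.+1, j < m) f i j) = \matrix_(i, j) opA a d f i j.
Proof.
apply/matrixP=> i j; rewrite !mxE.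
under eq_bigr do rewrite !mxE.
rewrite (sum_lower_bidiag (fun k => f k j)) /opA.
by case: (i : nat) => [|k]; rewrite ?mul1r.
Qed.

Lemma RB_mul a b c d m (f : nat -> nat -> F) :
  RB a b c d *m (\matrix_(i < d.+1, j < m) f i j) = \matrix_(i, j) opB a b c d f i j.
Proof.
apply/matrixP=> i j; rewrite !mxE.
under eq_bigr do rewrite !mxE.
rewrite (sum_upper_bidiag (fun k => f k j) (phiR a b c d)) /opB; congr (_ + _).
case: ltnP => // di; have -> : i.+1 = d.+1 by have := ltn_ord i; lia.
by rewrite phiR_last mul0r.
Qed.

(** Applied to the identity in this form, words in [RA] and [RB] are computed by iterating [opA] and
    [opB]. *)
Lemma mx1_nat_fun n :
  exists f : nat -> nat -> F, 1%:M = \matrix_(i < n, j < n) f i j.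
Proof. by exists (fun k l => (k == l)%:R); apply/matrixP=> i j; rewrite !mxE. Qed.

(** The scalar of [alpha]. Exchanging [a] and [b] gives minus the scalar of [beta], since [Delta]
    changes sign when [A] and [B] are exchanged. *)
Definition alphaR a b c d : F :=
  (c - b) * (c + b + 1) * (a - half_d F d) * (a + half_d F d + 1).

Lemma racah_AB a b c d :
  racah_rel (delta_R a b c d) (2 * alphaR a b c d) (RA a d) (RB a b c d).
Proof.
rewrite /racah_rel -[LHS]mulmx1 -[RHS]mulmx1.
have [f ->] := mx1_nat_fun d.+1.
rewrite !(mulmxDl, mulNmx, =^~ scalemxAl, =^~ mulmxA) !(RA_mul, RB_mul).
rewrite mul_scalar_mx; apply/matrixP=> i j; rewrite !mxE.
rewrite /opA /opB /delta_R /alphaR /thetaR /phiR !(natr_half d).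
(* Two factors [A] reach two rows back, so rows 0 and 1 are treated apart. *)
move: (half_d F d) => h; case: (i : nat) => [|[|k]]; ring.
Qed.

Lemma racah_BA a b c d :
  racah_rel (delta_R a b c d) (2 * alphaR b a c d) (RB a b c d) (RA a d).
Proof.
rewrite /racah_rel -[LHS]mulmx1 -[RHS]mulmx1.
have [f ->] := mx1_nat_fun d.+1.
rewrite !(mulmxDl, mulNmx, =^~ scalemxAl, =^~ mulmxA) !(RA_mul, RB_mul).
rewrite mul_scalar_mx; apply/matrixP=> i j; rewrite !mxE.
rewrite /opA /opB /delta_R /alphaR /thetaR /phiR !(natr_half d).
move: (half_d F d) => h; case: (i : nat) => [|k]; ring.
Qed.

(** The scalar is left implicit because only off-diagonal entries of the relation are used later. *)
Lemma racah_CB a b c d :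
  exists ka, racah_rel (delta_R a b c d) ka (RC a b c d) (RB a b c d).
Proof.
by eexists; rewrite /RC; apply: racah_rel_third (racah_AB _ _ _ _) (racah_BA _ _ _ _).
Qed.

End Racah.

(** * Explicit changes of basis and eigenbases *)

Section Bases.
Variable F : numFieldType.
Implicit Types (a b c x : F) (d : nat).

(* Column [i] is the product of the [C - thetaR c d h], [h < i], applied to the
   first basis vector; the factor [d - l] makes column [d.+1] vanish. *)
Definition trans_coef a b c d (j i : nat) : F :=
  (-1) ^+ i * 'C(i, j)%:R *
  \prod_(j <= l < i) ((d%:R - l%:R) * (a + b + c + half_d F d + 1 - l%:R)).

Lemma natr_binSl (i j : nat) : (j <= i)%N ->
  'C(i.+1, j)%:R = (i%:R + 1) * 'C(i, j)%:R / (i%:R + 1 - j%:R) :> F.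
Proof.
move=> ji; have nz : i%:R + 1 - j%:R != 0 :> F.
  by rewrite subr_eq0 natr1 eqr_nat; lia.
apply: (mulIf nz); rewrite divfK // natr1 -natrM (mul_bin_down i.+1 j) natrM.
by rewrite natrB ?leqW // mulrC.
Qed.

Lemma natr_binSr (i j : nat) :
  (j%:R + 1) * 'C(i, j.+1)%:R = (i%:R - j%:R) * 'C(i, j)%:R :> F.
Proof.
rewrite natr1 -natrM mul_bin_left natrM.
have [ji|ij] := leqP j i; first by rewrite natrB.
by rewrite bin_small // !mulr0.
Qed.

Lemma natr_bin_pred (i k : nat) : (k < i)%N ->
  'C(i, k)%:R = (k%:R + 1) * 'C(i, k.+1)%:R / (i%:R - k%:R) :> F.
Proof.
move=> ki; rewrite natr_binSr mulrAC divff ?mul1r //.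
by rewrite subr_eq0 eqr_nat; lia.
Qed.

(** Row [j] of the identity saying that column [i.+1] is [C - thetaR c d i] applied to column [i],
    with [C = delta - A - B]. *)
Lemma trans_coef_rec a b c d j i :
  trans_coef a b c d j i.+1 =
  (delta_R a b c d - thetaR a d j - thetaR b d j - thetaR c d i)
     * trans_coef a b c d j i
  - (if j is k.+1 then trans_coef a b c d k i else 0)
  - phiR a b c d j.+1 * trans_coef a b c d j.+1 i.
Proof.
rewrite /trans_coef.
(* When [i < j], nonzero terms occur only for [j = i.+1]. *)
have [ij|ji] := ltnP i j.
  case: j ij => // k; rewrite ltnS => ik.
  rewrite (bin_small (n := i) (m := k.+1)) // (bin_small (n := i) (m := k.+2)); last lia.
  have [->|ki] := eqVneq k i.
    by rewrite !binn !big_geq; [rewrite exprS !(mulr0, mul0r, mulr1) subr0; ring | lia..].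
  by rewrite !bin_small; [rewrite !(mulr0, mul0r) !subr0 | lia..].
pose p (l : nat) : F := (d%:R - l%:R) * (a + b + c + half_d F d + 1 - l%:R).
rewrite natr_binSl // big_nat_recr //= exprS.
(* All terms become rational multiples of [(-1) ^+ i * 'C(i, j)%:R * W], which leaves an identity
   for [field]. *)
set W := \prod_(j <= l < i) _.
have -> : phiR a b c d j.+1 * ((-1) ^+ i * 'C(i, j.+1)%:R *
    \prod_(j.+1 <= l < i) p l) =
    - ((a + b - c + half_d F d - j%:R) * (i%:R - j%:R) * (-1) ^+ i * 'C(i, j)%:R * W).
  have -> : phiR a b c d j.+1 = - ((j%:R + 1) * p j * (a + b - c + half_d F d - j%:R)).
    by rewrite /phiR /p -natr1; move: (half_d _ _) (d%:R) (j%:R) => h D J; ring.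
  have [jeqi|jlti] := eqVneq j i; first by rewrite jeqi bin_small //; ring.
  have -> : W = p j * \prod_(j.+1 <= l < i) p l.
    by rewrite /W big_ltn // ltn_neqAle jlti ji.
  move: (\prod_(j.+1 <= l < i) p l) (natr_binSr i j) => X E.
  rewrite -[(a + b - c + half_d F d - j%:R) * _ * _ * _]mulrA.
  rewrite [(-1) ^+ i * 'C(i, j)%:R]mulrC -[_ * (_ - _) * _]mulrA [(i%:R - j%:R) * _]mulrA -E.
  ring.
have nz : i%:R + 1 - j%:R != 0 :> F by rewrite subr_eq0 natr1 eqr_nat; lia.
case: j @p @W ji nz => [|k] p W ji nz.
  rewrite /delta_R /thetaR (natr_half F d); move: W (half_d F d) ((-1) ^+ i) => W h e.
  by field; rewrite -[_ + 1]subr0.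
have -> : \prod_(k <= l < i) p l = p k * W by rewrite big_ltn.
rewrite (natr_bin_pred ji) /p /delta_R /thetaR.
move: W ((-1) ^+ i) => W e; rewrite !(natr_half F d).
have nz' : i%:R - k%:R != 0 :> F by rewrite subr_eq0 eqr_nat; lia.
by move: (half_d F d) => h; field; rewrite nz'.
Qed.


Definition trans_mx a b c d : 'M[F]_d.+1 :=
  \matrix_(j < d.+1, i < d.+1) trans_coef a b c d j i.

Lemma trans_mx_unit a b c d : trans_mx a b c d \in unitmx.
Proof.
rewrite -unitmx_tr unitmxE det_trig; last first.
  apply/is_trig_mxP => i j ij; rewrite !mxE /trans_coef bin_small //.
  by rewrite mulr0 mul0r.
rewrite unitfE; apply/prodf_neq0 => i _; rewrite !mxE /trans_coef binn big_geq //.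
by rewrite !mulr1 signr_eq0.
Qed.

Lemma trans_coef_last a b c d j : (j <= d)%N -> trans_coef a b c d j d.+1 = 0.
Proof. by move=> jd; rewrite /trans_coef big_nat_recr //= subrr mul0r !mulr0. Qed.

Lemma RC_trans a b c d : RC a b c d *m trans_mx a b c d = trans_mx a b c d *m RA c d.
Proof.
rewrite /RC !mulmxBl RA_mul RB_mul mul_scalar_mx.
apply/matrixP=> j i; rewrite [RHS]mxE.
rewrite (eq_bigr (fun k : 'I_d.+1 => (if i == k :> nat then thetaR c d i
    else if k == i.+1 :> nat then 1 else 0) * trans_coef a b c d j k)); last first.
  by move=> k _; rewrite !mxE mulrC [k == i :> nat]eq_sym; case: eqP => // ->.
rewrite (sum_upper_bidiag (trans_coef a b c d j) (fun=> 1)).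
(* The missing superdiagonal term of the last column agrees with the vanishing column [d.+1]. *)
have -> : (if (i < d)%N then 1 * trans_coef a b c d j i.+1 else 0) =
    trans_coef a b c d j i.+1.
  case: ltnP => [_|di]; first by rewrite mul1r.
  have -> : i.+1 = d.+1 by have := ltn_ord i; lia.
  by rewrite trans_coef_last // -ltnS.
by rewrite trans_coef_rec !mxE /opA /opB; case: (j : nat) => [|k]; ring.
Qed.

Definition scale_mx a b c d : 'M[F]_d.+1 :=
  diag_mx (\row_i \prod_(0 <= k < i) phiR a b c d k.+1).

Lemma trRB_scale a b c d :
  (RB a b c d)^T *m scale_mx a b c d = scale_mx a b c d *m RA b d.
Proof.
rewrite /scale_mx mul_mx_diag mul_diag_mx; apply/matrixP=> i j; rewrite !mxE.
have [->|ij] := eqVneq (i : nat) j; first by rewrite mulrC.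
case: eqP => [->|]; last by rewrite mul0r mulr0.
by rewrite big_nat_recr //= mulr1 mulrC.
Qed.

Lemma scale_mx_unit a b c d :
  (forall i : nat, (1 <= i <= d)%N -> phiR a b c d i != 0) ->
  scale_mx a b c d \in unitmx.
Proof.
move=> nz; rewrite unitmxE det_diag unitfE; apply/prodf_neq0 => i _.
rewrite mxE big_mkord; apply/prodf_neq0 => k _; apply: nz.
by have := ltn_ord k; have := ltn_ord i; lia.
Qed.

Lemma avoids_bad_neq d x (k : nat) : avoids_bad_set d x ->
  (1 <= k <= (2 * d).-1)%N -> 2 * x + d%:R + 1 != k%:R.
Proof.
move=> av kd; apply: contra (av _ kd) => /eqP <-.
by apply/eqP; field.
Qed.

Lemma thetaRB d x (i j : nat) : thetaR x d i - thetaR x d j =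
  (j%:R - i%:R) * (2 * x + d%:R + 1 - (i + j)%:R).
Proof. by rewrite /thetaR (natr_half F d); move: (half_d F d) => h; ring. Qed.

(** Two distinct indices up to [d] have a sum between 1 and [2 * d - 1], a value that [2 x + d + 1]
    avoids. *)
Lemma thetaR_inj d x (i j : nat) : avoids_bad_set d x ->
  (i <= d)%N -> (j <= d)%N -> i != j -> thetaR x d i - thetaR x d j != 0.
Proof.
move=> av id jd ij; rewrite thetaRB mulf_neq0 // subr_eq0.
  by rewrite eqr_nat eq_sym.
apply: avoids_bad_neq av _; lia.
Qed.

(* With [u := j - i] and [v := 2 x + d + 1 - i - j] the coefficient is
   [(u^2 - 1) (v^2 - 1)]. *)
Lemma thetaR_coef_neq0 d x (i j : nat) : avoids_bad_set d x ->
  (i <= d)%N -> (i.+1 < j)%N -> (j <= d)%N ->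
  (thetaR x d i - thetaR x d j) ^+ 2 - 2 * (thetaR x d i + thetaR x d j) != 0.
Proof.
move=> av id ij jd.
have -> : (thetaR x d i - thetaR x d j) ^+ 2 - 2 * (thetaR x d i + thetaR x d j) =
  (j%:R - i.+1%:R) * (j.+1%:R - i%:R) * (2 * x + d%:R + 1 - (i + j).+1%:R)
    * (2 * x + d%:R + 1 - (i + j).-1%:R).
  have -> : (i + j).-1%:R = i%:R + j%:R - 1 :> F.
    by rewrite -[in RHS]natrD -{2}(prednK (n := i + j)) ?natr1 -?natr1 ?addrK //; lia.
  by rewrite /thetaR (natr_half F d); move: (half_d F d) => h; ring.
(* From [i.+1 < j <= d], both [i + j - 1] and [i + j + 1] lie between 1 and [2 * d - 1]. *)
rewrite !mulf_neq0 //; rewrite subr_eq0 ?eqr_nat; try lia.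
all: by apply: avoids_bad_neq av _; lia.
Qed.

(* Below the diagonal, [P i.-1 j = (theta_j - theta_i) P i j]. *)
Definition eigen_mx x d : 'M[F]_d.+1 :=
  \matrix_(i, j) (if (j <= i)%N
     then \prod_(j.+1 <= k < i.+1) (thetaR x d j - thetaR x d k)^-1 else 0).

Lemma eigen_mx_unit x d : eigen_mx x d \in unitmx.
Proof.
rewrite unitmxE det_trig; last first.
  by apply/is_trig_mxP => i j ij; rewrite mxE leqNgt ij.
rewrite unitfE; apply/prodf_neq0 => i _; rewrite mxE leqnn big_geq //.
exact: oner_neq0.
Qed.

Definition theta_row x d : 'rV[F]_d.+1 := \row_i thetaR x d i.

Lemma RA_eigen x d : avoids_bad_set d x ->
  RA x d *m eigen_mx x d = eigen_mx x d *m diag_mx (theta_row x d).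
Proof.
move=> av; rewrite (@RA_mul F x d d.+1 (fun i j : nat => if (j <= i)%N
     then \prod_(j.+1 <= k < i.+1) (thetaR x d j - thetaR x d k)^-1 else 0)).
rewrite mul_mx_diag; apply/matrixP=> i j; rewrite !mxE /opA.
have [ji|ij|<-] := ltngtP j i; last 2 first.
- by case: (i : nat) ij => [|k] ki; rewrite ?[(j <= k)%N]leqNgt
    ?(ltnW ki) /= mulr0 mul0r addr0.
- rewrite big_geq //; by case: (j : nat) => [|k]; rewrite ?ltnn addr0 mulr1 mul1r.
have: thetaR x d j - thetaR x d i != 0.
  by apply: thetaR_inj => //; rewrite ?ltn_eqF // -ltnS.
case: (i : nat) ji => // k; rewrite ltnS => jk nz.
rewrite jk big_nat_recr //=. move: (\prod_(_ <= _ < _) _) => X.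
(by field).
Qed.

End Bases.

(** * Tridiagonality in an eigenbasis, and diagonalizability of [RA] *)

Section LeonardTriples.
Variable F : numFieldType.
Implicit Types (a b c x : F) (d : nat).

(** Off the diagonal the third matrix equals [- M]. *)
Lemma irred_tridiagonal_third n del (D M : 'M[F]_n) :
  diagonal D -> irred_tridiagonal M -> irred_tridiagonal (del%:M - D - M).
Proof.
move=> dD [tM nM].
have off i j : i != j -> (del%:M - D - M) i j = - M i j.
  by move=> ij; rewrite !mxE (negPf ij) dD // mulr0n !sub0r oppr0 add0r.
split=> i j ij.
  by rewrite off ?tM ?oppr0 //; apply: contraPneq ij => ->; lia.
by rewrite off ?oppr_eq0 ?nM //; apply: contraPneq ij => ->; lia.
Qed.

Lemma racah_tridiagonal d x del ka (L M P : 'M[F]_d.+1) :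
  avoids_bad_set d x -> P \in unitmx ->
  L *m P = P *m diag_mx (theta_row x d) -> racah_rel del ka L M ->
  tridiagonal (invmx P *m M *m P).
Proof.
move=> av uP LP /(racah_rel_conj uP).
rewrite (diagonal_invmx uP LP); move: (invmx P *m M *m P) => K rel i j ij.
have nij : i != j by apply: contraPneq ij => ->; lia.
have nz : (thetaR x d i - thetaR x d j) ^+ 2 - 2 * (thetaR x d i + thetaR x d j) != 0.
  have [ltij|ltji] := ij.
    by apply: thetaR_coef_neq0 => //; rewrite -ltnS.
  rewrite -sqrrN opprB [thetaR x d i + _]addrC.
  by apply: thetaR_coef_neq0 => //; rewrite -ltnS.
(* Entry [(i, j)] of the relation is this coefficient times [K i j]: the terms without [M] are
   diagonal. *)
apply: (mulfI nz); rewrite mulr0.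
move: rel; rewrite /racah_rel -[K *m _ *m _]mulmxA !mulmx_diag.
rewrite !(mul_mx_diag, mul_diag_mx).
move=> /matrixP/(_ i j); rewrite !mxE (negPf nij) !mulr0n.
by move=> E; rewrite -E; ring.
Qed.

Lemma leonard_triple_component d x del ka (L M P : 'M[F]_d.+1) :
  avoids_bad_set d x -> irreducible_pair L M -> P \in unitmx ->
  L *m P = P *m diag_mx (theta_row x d) -> racah_rel del ka L M ->
  [/\ diagonal (invmx P *m L *m P), irred_tridiagonal (invmx P *m M *m P) &
      irred_tridiagonal (invmx P *m (del%:M - L - M) *m P)].
Proof.
move=> av irr uP LP rel.
have dL : diagonal (invmx P *m L *m P).
  rewrite (diagonal_invmx uP LP) => i j ij.
  by rewrite mxE (negPf ij) mulr0n.
have tM := irreducible_pair_tridiag irr uP dL (racah_tridiagonal av uP LP rel).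
split=> //; rewrite !(mulmxBr, mulmxBl) mul_mx_scalar -scalemxAl mulVmx //.
by rewrite scalemx1; apply: irred_tridiagonal_third.
Qed.

(** Makes the first basis vector cyclic: its image under the [k]-th power has last nonzero
    coordinate 1, at position [k]. *)
Lemma RA_expr_col0 x d (k i : nat) (id : (i < d.+1)%N) :
  (k <= i)%N -> (RA x d ^+ k) (Ordinal id) 0 = (i == k)%:R.
Proof.
elim: k i id => [|k IH] i id ki; first by rewrite expr0 mxE.
rewrite exprS mxE.
(* The column as a sequence on nat; the default 0 is never reached. *)
pose g := fun m : nat => if insub m is Some o then (RA x d ^+ k) o 0 else 0.
have gE (m : nat) (md : (m < d.+1)%N) : g m = (RA x d ^+ k) (Ordinal md) 0.
  by rewrite /g insubT.
rewrite (eq_bigr (fun l : 'I_d.+1 => (if i == l :> nat then thetaR x d i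
    else if i == l.+1 :> nat then 1 else 0) * g l)); last first.
  by case=> l ld _; rewrite mxE /= -gE.
rewrite (sum_lower_bidiag g _ _ (Ordinal id)) /=.
case: i id ki => // m md km; rewrite (gE _ md) IH ?(ltnW km) // gtn_eqF //.
rewrite (gE _ (ltnW md)) IH // mulr0 add0r mul1r.
by rewrite eqSS.
Qed.

Lemma RA_annihilator_size x d (p : {poly F}) :
  horner_mx (RA x d) p = 0 -> p != 0 -> (d.+1 < size p)%N.
Proof.
move=> p0 nz; rewrite ltnNge; apply/negP => sp.
have sp0 : (0 < size p)%N by rewrite size_poly_gt0.
have kd : ((size p).-1 < d.+1)%N by rewrite prednK.
have lts : ((size p).-1 < size p)%N by rewrite prednK.
have pE : horner_mx (RA x d) p = \sum_(i < size p) p`_i *: RA x d ^+ i.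
  rewrite -{1}(coefK p) poly_def linear_sum; apply: eq_bigr => i _.
  by rewrite linearZ /= rmorphXn /= horner_mx_X.
(* Only the top power of [RA] contributes at the row given by the degree of [p]. *)
have : (horner_mx (RA x d) p) (Ordinal kd) 0 = lead_coef p.
  rewrite pE summxE (bigD1 (Ordinal lts)) //= mxE RA_expr_col0 // eqxx mulr1.
  rewrite big1 ?addr0 // => i; rewrite -val_eqE /= => ilt.
  have := ltn_ord i; rewrite -{2}(prednK sp0) ltnS => ile.
  by rewrite mxE RA_expr_col0 // eq_sym (negPf ilt) mulr0.
by rewrite p0 mxE => /esym/eqP; rewrite lead_coef_eq0 (negPf nz).
Qed.

(** The minimal polynomial has degree [d.+1], so the characteristic polynomial divides it and is
    separable; its roots [thetaR x d i] are then distinct. *)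
Lemma RA_diagonalizable_avoids x d : diagonalizable (RA x d) -> avoids_bad_set d x.
Proof.
move=> /diagonalizableP[rs urs pmin].
have sep : separable_poly (char_poly (RA x d)).
  suff cm : char_poly (RA x d) %| mxminpoly (RA x d).
    by apply: dvdp_separable (dvdp_trans cm pmin) _; rewrite separable_prod_XsubC.
  have := dvdp_size_eqp (mxminpoly_dvd_char (RA x d)).
  suff -> : size (mxminpoly (RA x d)) == size (char_poly (RA x d)).
    by move/esym/andP=> [].
  rewrite eqn_leq dvdp_leq ?mxminpoly_dvd_char ?monic_neq0 ?char_poly_monic //.
  rewrite size_char_poly (@RA_annihilator_size x) ?mx_root_minpoly //.
  by rewrite monic_neq0 ?mxminpoly_monic.
have inj : injective (fun i : 'I_d.+1 => thetaR x d i).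
  apply/injectiveP; rewrite /injectiveb /dinjectiveb -separable_prod_XsubC.
  rewrite big_map big_enum /=.
  suff <- : char_poly (RA x d) = \prod_(i < d.+1) ('X - (thetaR x d i)%:P) by [].
  rewrite char_poly_trig; last first.
    by apply/is_trig_mxP => i j ij; rewrite mxE ltn_eqF // ltn_eqF // leqW.
  by apply: eq_bigr => i _; rewrite mxE eqxx.
move=> k kd; apply/eqP => xE.
have eqt (i j : nat) : (i + j = k)%N -> thetaR x d i = thetaR x d j.
  move=> ijk; apply/eqP; rewrite -subr_eq0 thetaRB ijk xE; apply/eqP.
  have two : 2 != 0 :> F by rewrite pnatr_eq0.
  by field.
(* Two distinct indices with sum [k]: 0 and [k] if [k <= d], otherwise [k - d] and [d]. *)
have [kled|dltk] := leqP k d.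
  have kd1 : (k < d.+1)%N by [].
  by have /(congr1 val) /= := inj 0 (Ordinal kd1) (eqt 0 k erefl); lia.
have kd1 : (k - d < d.+1)%N by lia.
have /(congr1 val) /= := inj (Ordinal kd1) ord_max (eqt (k - d)%N d (subnK (ltnW dltk))).
lia.
Qed.

Lemma RA_third a b c d :
  (delta_R a b c d)%:M - RC a b c d - RB a b c d = RA a d.
Proof. by rewrite /RC -[_ - RA a d - _]addrA -opprD subKr addrK. Qed.

(** * Consequences of irreducibility and the three implications *)

Section Irreducible.
Variables (a b c : F) (d : nat).
Hypothesis irr : Rd_irreducible a b c d.

Lemma irreducible_pair_AB : irreducible_pair (RA a d) (RB a b c d).
Proof.
move=> U iA iB; apply: irr => //.
  by rewrite /RC !mx_invariantD ?mx_invariantN ?mx_invariant_scalar.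
by rewrite /RDelta mx_invariantZ // mx_invariantD ?mx_invariantN ?mx_invariantM.
Qed.

Lemma irreducible_pair_CB : irreducible_pair (RC a b c d) (RB a b c d).
Proof.
move=> U iC iB; apply: irreducible_pair_AB => //.
by rewrite -(RA_third a b c) !mx_invariantD ?mx_invariantN ?mx_invariant_scalar.
Qed.

(** If [phiR] vanished at [i], the basis vectors from index [i] on would span a proper invariant
    subspace. *)
Lemma phiR_neq0 (i : nat) : (1 <= i <= d)%N -> phiR a b c d i != 0.
Proof.
move=> /andP[i0 id]; apply/eqP => phi0.
have id1 : (i < d.+1)%N by [].
apply: (@irreducible_pair_coord _ _ _ _ 1%:M (fun k => i <= k)%N (Ordinal id1) 0
  irreducible_pair_AB); rewrite ?unitmx1 ?invmx1 //=.
- by rewrite -ltnNge.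
- move=> k l ik; rewrite -ltnNge mulmx1 mul1mx mxE => li.
  by rewrite !ltn_eqF //; lia.
move=> k l ik; rewrite -ltnNge mulmx1 mul1mx mxE => li.
rewrite ltn_eqF; last lia.
by case: eqP => // kl; have <- : i = k by lia.
Qed.

(** The columns of [Q^T] are eigenvectors of the transpose of [RB], so those of [invmx Q] are
    eigenvectors of [RB]. *)
Lemma RB_eigenbasis : avoids_bad_set d b ->
  exists2 P : 'M[F]_d.+1, P \in unitmx &
    RB a b c d *m P = P *m diag_mx (theta_row b d).
Proof.
move=> av; set Q := (scale_mx a b c d *m eigen_mx b d)^T.
have uQ : Q \in unitmx.
  by rewrite unitmx_tr unitmx_mul eigen_mx_unit scale_mx_unit //; apply: phiR_neq0.
exists (invmx Q); first by rewrite unitmx_inv.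
apply: (can_inj (mulKmx uQ)); rewrite mulKVmx //; apply: (can_inj (mulmxK uQ)) => /=.
rewrite mulmxA mulmxKV // -[RB _ _ _ _]trmxK -trmx_mul mulmxA trRB_scale.
by rewrite -mulmxA RA_eigen // mulmxA trmx_mul tr_diag_mx.
Qed.

Lemma RC_eigenbasis : avoids_bad_set d c ->
  exists2 P : 'M[F]_d.+1, P \in unitmx &
    RC a b c d *m P = P *m diag_mx (theta_row c d).
Proof.
move=> av; exists (trans_mx a b c d *m eigen_mx c d).
  by rewrite unitmx_mul trans_mx_unit eigen_mx_unit.
by rewrite mulmxA RC_trans -!mulmxA RA_eigen.
Qed.

Lemma avoids_leonard_triple :
  [/\ avoids_bad_set d a, avoids_bad_set d b & avoids_bad_set d c] ->
  leonard_triple (RA a d) (RB a b c d) (RC a b c d).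
Proof.
move=> [ava avb avc]; split=> //.
- exists (eigen_mx a d); first exact: eigen_mx_unit.
  apply: leonard_triple_component (RA_eigen ava) (racah_AB _ _ _ _) => //.
    exact: irreducible_pair_AB.
  exact: eigen_mx_unit.
- have [P uP BP] := RB_eigenbasis avb; exists P => //.
  have [|] := leonard_triple_component avb _ uP BP (racah_BA _ _ _ _).
    by move=> U iB iA; apply: irreducible_pair_AB.
  by rewrite addrAC.
have [P uP CP] := RC_eigenbasis avc; exists P => //.
have [ka rel] := racah_CB a b c d.
have [dC tB] := leonard_triple_component avc irreducible_pair_CB uP CP rel.
by rewrite RA_third.
Qed.

Lemma leonard_triple_diagonalizable :
  leonard_triple (RA a d) (RB a b c d) (RC a b c d) ->
  [/\ diagonalizable (RA a d), diagonalizable (RB a b c d)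
    & diagonalizable (RC a b c d)].
Proof.
by case=> _ [P uP [dA _ _]] [Q uQ [dB _ _]] [S uS [dC _ _]]; split;
  [apply: diagonal_diagonalizable dA|apply: diagonal_diagonalizable dB
  |apply: diagonal_diagonalizable dC].
Qed.

Lemma diagonalizable_avoids :
  [/\ diagonalizable (RA a d), diagonalizable (RB a b c d)
    & diagonalizable (RC a b c d)] ->
  [/\ avoids_bad_set d a, avoids_bad_set d b & avoids_bad_set d c].
Proof.
case=> dA dB dC; split; apply: RA_diagonalizable_avoids => //.
- apply: diagonalizable_sim (trRB_scale a b c d) (diagonalizable_tr dB).
  exact: scale_mx_unit phiR_neq0.
- exact: diagonalizable_sim (trans_mx_unit a b c d) (RC_trans a b c d) dC.
Qed.

End Irreducible.
End LeonardTriples.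

Theorem theorem6p9 (R : realType) (a b c : R[i]) (d : nat) :
  Rd_irreducible a b c d ->
  [/\ (leonard_triple (RA a d) (RB a b c d) (RC a b c d) <->
       [/\ diagonalizable (RA a d), diagonalizable (RB a b c d)
         & diagonalizable (RC a b c d)]),
      ([/\ diagonalizable (RA a d), diagonalizable (RB a b c d)
         & diagonalizable (RC a b c d)] <->
       [/\ avoids_bad_set d a, avoids_bad_set d b & avoids_bad_set d c]) &
      (leonard_triple (RA a d) (RB a b c d) (RC a b c d) <->
       [/\ avoids_bad_set d a, avoids_bad_set d b & avoids_bad_set d c])].
Proof.
move=> irr.
have i_ii := @leonard_triple_diagonalizable _ a b c d.
have ii_iii := diagonalizable_avoids irr.
have iii_i := avoids_leonard_triple irr.
by split; split; auto.
Qed.
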